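(* Let $0<\epsilon\ll 1$, let $B=(B_1,B_2,B_3)^{\intercal}\in\mathbb{R}^3$ be a constant vector with $|B|\ge 1$, let $\tilde B$ be the skew-symmetric matrix with $v\times B=\tilde B v$ for all $v\in\mathbb{R}^3$, and let $F(x)=-\nabla_x U(x)$ for a scalar potential $U$ on $\mathbb{R}^3$. Let $(x_n,v_n)_{n\ge 0}$ be generated by the EEP integrator with stepsize $h$, $$x_{n+1}=x_{n}+h\varphi_1\big(\tfrac{h}{\epsilon}\tilde B\big)v_{n}+h^2\varphi_2\big(\tfrac{h}{\epsilon}\tilde B\big)\int_0^1F\big(x_n+\sigma(x_{n+1}-x_n)\big)\,d\sigma,$$ $$v_{n+1}=e^{\frac{h}{\epsilon}\tilde B}v_n+h\varphi_1\big(\tfrac{h}{\epsilon}\tilde B\big)\int_0^1F\big(x_n+\sigma(x_{n+1}-x_n)\big)\,d\sigma.$$ Then the energy $E(x,v)=\frac12|v|^2+U(x)$ is preserved exactly: $$E(x_{n+1},v_{n+1})=E(x_n,v_n)\qquad\text{for } n=0,1,\ldots.$$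
   Context: The functions $\varphi_k$ are $\varphi_0(z)=e^z$ and $\varphi_k(z)=\int_0^1 e^{(1-\sigma)z}\frac{\sigma^{k-1}}{(k-1)!}\,d\sigma$ for $k=1,2$; they are entire functions, evaluated at matrices. Explicitly, $$\tilde B=\begin{pmatrix}0&B_3&-B_2\\ -B_3&0&B_1\\ B_2&-B_1&0\end{pmatrix}.$$ The method is designed for the system $\dot x=v$, $\dot v=\frac1\epsilon\tilde Bv+F(x)$. $|\cdot|$ is the Euclidean norm. *)

(* Defs.v *)
From HB Require Import structures.
From mathcomp Require Import all_boot all_order all_algebra.
From mathcomp Require Import all_classical all_reals all_analysis.

Set Implicit Arguments.
Unset Strict Implicit.
Unset Printing Implicit Defensive.

Import Order.TTheory GRing.Theory Num.Theory.
Import numFieldNormedType.Exports.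

Local Open Scope classical_set_scope.
Local Open Scope ring_scope.

(* The library norm on matrices is the sup norm, hence this definition of the
   Euclidean one. *)
Definition enorm (R : realType) (v : 'cV[R]_3) : R :=
  Num.sqrt (\sum_(i < 3) v i 0 ^+ 2).

Definition mx_of_rows (R : realType) (s : seq (seq R)) : 'M[R]_3 :=
  \matrix_(i < 3, j < 3) nth 0 (nth [::] s i) j.

Definition crossmul (R : realType) (u w : 'cV[R]_3) : 'cV[R]_3 :=
  \col_(i < 3) nth 0 [:: u 1 0 * w 2 0 - u 2 0 * w 1 0;
                         u 2 0 * w 0 0 - u 0 0 * w 2 0;
                         u 0 0 * w 1 0 - u 1 0 * w 0 0] i.

Definition tilde (R : realType) (B : 'cV[R]_3) : 'M[R]_3 :=
  mx_of_rows [:: [::        0;    B 2 0; - (B 1 0)];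
                 [:: - B 2 0;        0;     B 0 0];
                 [::    B 1 0; - (B 0 0);       0]].

Lemma tildeE (R : realType) (B v : 'cV[R]_3) : tilde B *m v = crossmul v B.
Proof.
apply/colP => i; rewrite !mxE !big_ord_recl big_ord0 !mxE.
have [-> ->] : lift ord0 ord0 = 1 :> 'I_3 /\
    lift ord0 (lift ord0 ord0) = 2 :> 'I_3 by split; apply/val_inj.
case: i => -[|[|[|//]]] ? /=; rewrite ?mul0r ?addr0 ?add0r !mulNr;
  by rewrite ?(mulrC (B _ _)) // addrC.
Qed.

Lemma tilde_skew (R : realType) (B : 'cV[R]_3) : (tilde B)^T = - tilde B.
Proof.
apply/matrixP => -[[|[|[|//]]] ?] [[|[|[|//]]] ?];
  by rewrite !mxE /= ?opprK ?oppr0.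
Qed.

Definition expmx (R : realType) (n : nat) (A : 'M[R]_n.+1) : 'M[R]_n.+1 :=
  limn (series (fun k : nat => (k`!%:R)^-1 *: A ^+ k)).

Definition intmx (R : realType) (m n : nat) (G : R -> 'M[R]_(m, n)) :
    'M[R]_(m, n) :=
  \matrix_(i, j) \int[lebesgue_measure]_(s in `[0, 1]) G s i j.

(* phi_k at a matrix: its integral formula, with the scalar exponential
   replaced by the matrix exponential. *)
Definition phi (R : realType) (n k : nat) (A : 'M[R]_n.+1) : 'M[R]_n.+1 :=
  if k is k'.+1 then
    intmx (fun s : R => (s ^+ k' / k'`!%:R) *: expmx ((1 - s) *: A))
  else expmx A.

Definition gradient (R : realType) (U : 'cV[R]_3 -> R) (x : 'cV[R]_3) :
    'cV[R]_3 :=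
  \col_(i < 3) 'D_(delta_mx i 0) U x.

Definition energy (R : realType) (U : 'cV[R]_3 -> R) (x v : 'cV[R]_3) : R :=
  2^-1 * enorm v ^+ 2 + U x.

(* One step of the (implicit) integrator from (x, v) to (x', v'). *)
Definition EEP_step (R : realType) (eps h : R) (B : 'cV[R]_3)
    (F : 'cV[R]_3 -> 'cV[R]_3) (x v x' v' : 'cV[R]_3) : Prop :=
  let K := (h / eps) *: tilde B in
  let avgF := intmx (fun s : R => F (x + s *: (x' - x))) in
  x' = x + h *: (phi 1%N K *m v) + h ^+ 2 *: (phi 2%N K *m avgF) /\
  v' = expmx K *m v + h *: (phi 1%N K *m avgF).

(* Main.v *)
Require Import Defs.
From HB Require Import structures.
From mathcomp Require Import all_boot all_order all_algebra.
From mathcomp Require Import all_classical all_reals all_analysis.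
From mathcomp Require Import ring.

(** The kinetic energy gained in one step is exactly the potential energy lost.

    Write K = (h / eps) * tilde B, let E, P, Q be phi_0, phi_1, phi_2 evaluated
    at K, and let g be the average of F over the segment from x to x'.  Since K
    is skew, transposing an entire function of K amounts to replacing K by - K,
    so the scalar identities
<<
      e^(-z) e^z = 1,   e^(-z) phi_1(z) = phi_1(-z),
      phi_1(-z) phi_1(z) = phi_2(z) + phi_2(-z)
>>
    become E^T E = 1, E^T P = P^T and P^T P = Q + Q^T.  Expanding
    |E v + h P g|^2 with these gives |v'|^2 = |v|^2 + 2 <g, x' - x>
    ([kinetic_gain]).  On the other hand, the fundamental theorem of calculus
    along the segment gives U x - U x' = <g, x' - x> ([potential_drop]), and the
    two balance.

    The three matrix identities are obtained from closed forms.  A multiple K of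
    tilde B satisfies K^3 = - t^2 K with t = (h / eps) |B|, so every power series
    in K lies in the span of 1, K and K^2.  Summing the exponential series gives
    Rodrigues' formula ([rodrigues]); integrating its coefficients gives P and Q
    ([phi1E], [phi2E]); and the identities reduce to sin^2 + cos^2 = 1.  The
    degenerate case K = 0 needs no separate treatment, as 0 satisfies
    K^3 = - t^2 K for t = 1 as well. *)

Set Implicit Arguments.
Unset Strict Implicit.
Unset Printing Implicit Defensive.

Import Order.TTheory GRing.Theory Num.Theory.
Import numFieldNormedType.Exports.

Local Open Scope classical_set_scope.
Local Open Scope ring_scope.

(** * Quadratic polynomials in a matrix with A^3 = - q A *)

Definition quad (R : comNzRingType) (n : nat) (A : 'M[R]_n.+1) (a b c : R) :=
  a *: 1 + b *: A + c *: A ^+ 2.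

Lemma quad_add (R : comNzRingType) (n : nat) (A : 'M[R]_n.+1)
    (a b c a' b' c' : R) :
  quad A a b c + quad A a' b' c' = quad A (a + a') (b + b') (c + c').
Proof. by rewrite /quad !scalerDl addrACA; congr (_ + _); rewrite addrACA. Qed.

Lemma quad_mul (R : comNzRingType) (n : nat) (A : 'M[R]_n.+1)
    (q a b c a' b' c' : R) :
  A ^+ 3 = - q *: A ->
  quad A a b c * quad A a' b' c' =
    quad A (a * a') (a * b' + b * a' - q * (b * c' + c * b'))
      (a * c' + b * b' + c * a' - q * (c * c')).
Proof.
move=> A3; rewrite /quad !mulrDl !mulrDr -!scalerAl -!scalerAr !mul1r !mulr1.
rewrite !scalerA.
have -> : A * A ^+ 2 = - q *: A by rewrite -exprS.
have -> : A ^+ 2 * A = - q *: A by rewrite -exprSr.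
have -> : A ^+ 2 * A ^+ 2 = - q *: A ^+ 2.
  by rewrite -exprD (_ : 2 + 2 = 3 + 1)%N // exprD A3 -scalerAl -expr2.
rewrite -expr2 !scalerDl !scalerA.
by apply/matrixP => i j; rewrite !mxE; ring.
Qed.

Lemma quad_tr (R : comNzRingType) (n : nat) (A : 'M[R]_n.+1) (a b c : R) :
  A^T = - A -> (quad A a b c)^T = quad A a (- b) c.
Proof.
move=> AT; rewrite /quad !linearD !linearZ /= trmx1 expr2 trmx_mul AT.
by rewrite mulmxN mulNmx opprK scalerN scaleNr.
Qed.

Lemma cubic_expr_odd (R : comNzRingType) (n : nat) (A : 'M[R]_n.+1) (q : R)
    (m : nat) :
  A ^+ 3 = - q *: A -> A ^+ m.*2.+1 = (- q) ^+ m *: A.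
Proof.
move=> A3; elim: m => [|m IH]; first by rewrite expr1 expr0 scale1r.
rewrite doubleS -[m.*2.+3]addn2 exprD IH -scalerAl -exprS A3 scalerA.
by rewrite exprSr.
Qed.

(** * Rodrigues' formula *)

(** As A^(2m+1) = (- t^2)^m A and A^(2m+2) = (- t^2)^m A^2, the odd terms of the
    exponential series are those of sin (s t) / t and the even ones, but for the
    constant term, those of - cos (s t) / t^2.  The sequence [cos_coeff 0] is
    1, 0, 0, ...: it supplies the term of index 0 and already appears as a
    trigonometric series, so that all the limits come from the same lemmas. *)
Lemma expmx_term (R : realType) (n : nat) (A : 'M[R]_n.+1) (t s : R) (k : nat) :
  t != 0 -> A ^+ 3 = - t ^+ 2 *: A ->
  (k`!%:R)^-1 *: (s *: A) ^+ k =
    quad A (cos_coeff 0 k) (sin_coeff (s * t) k / t)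
      ((cos_coeff 0 k - cos_coeff (s * t) k) / t ^+ 2).
Proof.
move=> t0 A3; rewrite /quad exprZn scalerA.
have kn0 m : (m`!)%:R != 0 :> R by rewrite pnatr_eq0 -lt0n fact_gt0.
rewrite -[k]odd_double_half; case: (odd k); rewrite (add0n, add1n);
  move: (k./2) => m.
- rewrite !cos_coeff_odd subrr mul0r !scale0r add0r addr0 -sin_coeff'E.
  rewrite /sin_coeff' -exprnP (cubic_expr_odd _ A3) scalerA; congr (_ *: _).
  rewrite exprMn [t ^+ m.*2.+1]exprS -mul2n (exprM t) [(- _) ^+ _]exprNn.
  by field; rewrite t0 kn0.
- rewrite sin_coeff_even mul0r scale0r addr0 -!cos_coeff'E /cos_coeff' -!exprnP.
  case: m => [|m].
    by rewrite fact0 !expr0 subrr !mul0r scale0r addr0 invr1 !mulr1.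
  rewrite doubleS (exprS 0) mul0r mulr0 mul0r scale0r !add0r.
  have -> : A ^+ m.*2.+2 = (- t ^+ 2) ^+ m *: A ^+ 2.
    by rewrite exprSr (cubic_expr_odd _ A3) -scalerAl -expr2.
  rewrite scalerA; congr (_ *: _); rewrite exprMn.
  rewrite [t ^+ m.*2.+2]exprS [t ^+ m.*2.+1]exprS -mul2n (exprM t).
  rewrite [(- _ ^+ 2) ^+ _]exprNn [(-1) ^+ m.+1]exprS.
  by field; rewrite t0 kn0.
Qed.

Lemma rodrigues (R : realType) (n : nat) (A : 'M[R]_n.+1) (t s : R) :
  t != 0 -> A ^+ 3 = - t ^+ 2 *: A ->
  expmx (s *: A) =
    quad A 1 (sin (s * t) / t) ((1 - cos (s * t)) / t ^+ 2).
Proof.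
move=> t0 A3; rewrite /quad /expmx; apply: cvg_lim; first exact: norm_hausdorff.
have cvg_cos (z : R) : series (cos_coeff z) @ \oo --> cos z.
  by rewrite cos.unlock; exact: is_cvg_series_cos_coeff.
have cvg_sin (z : R) : series (sin_coeff z) @ \oo --> sin z.
  by rewrite sin.unlock; exact: is_cvg_series_sin_coeff.
have -> : series (fun k => (k`!%:R)^-1 *: (s *: A) ^+ k) =
    (fun N => series (cos_coeff 0) N *: 1 +
      (series (sin_coeff (s * t)) N / t) *: A +
      ((series (cos_coeff 0) N - series (cos_coeff (s * t)) N) / t ^+ 2)
        *: A ^+ 2).
  apply/funext => N; rewrite /series /=.
  under eq_bigr do rewrite (expmx_term _ _ t0 A3).
  by rewrite !big_split /= -!scaler_suml sumrB.
have c0 := cvg_cos 0; rewrite cos0 in c0.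
apply: cvgD; [apply: cvgD|]; apply: cvgZr_tmp => //.
- by apply: cvgMr_tmp; exact: cvg_sin.
- by apply: cvgMr_tmp; apply: cvgB => //; exact: cvg_cos.
Qed.

(** * Closed forms of phi_1 and phi_2 *)

Lemma Rintegral_FTC (R : realType) (f F : R -> R) :
  continuous f -> (forall s : R, is_derive s (1 : R) F (f s)) ->
  \int[lebesgue_measure]_(s in `[0, 1]) f s = F 1 - F 0.
Proof.
move=> cf dF; rewrite /Rintegral (@continuous_FTC2 _ f F) //.
- exact/continuous_subspaceT.
- have cF : continuous F.
    move=> s; apply/differentiable_continuous/derivable1_diffP.
    exact: ex_derive.
  split; first by move=> s _; exact: ex_derive.
  + exact/cvg_at_right_filter/cF.
  + exact/cvg_at_left_filter/cF.
- by move=> s _; rewrite derive1E derive_val.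
Qed.

Lemma is_derive_comp_rev (R : realType) (f f' : R -> R) (t : R) :
  (forall u : R, is_derive u (1 : R) f (f' u)) ->
  forall s : R, is_derive s (1 : R) (fun s => f ((1 - s) * t))
    (f' ((1 - s) * t) * - t).
Proof.
move=> df s.
have h : is_derive s (1 : R) (fun s => (1 - s) * t) (- t).
  by apply: is_derive_eq; rewrite -![_ *: _]/(_ * _); ring.
exact: (@is_derive1_comp _ f (fun s => (1 - s) * t)).
Qed.

Lemma phi_entry (R : realType) (n k : nat) (A : 'M[R]_n.+1) (t : R) i j :
  t != 0 -> A ^+ 3 = - t ^+ 2 *: A ->
  phi k.+1 A i j = \int[lebesgue_measure]_(s in `[0, 1])
    (s ^+ k / k`!%:R * ((1 : 'M[R]_n.+1) i j + sin ((1 - s) * t) / t * A i j +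
      (1 - cos ((1 - s) * t)) / t ^+ 2 * (A ^+ 2) i j)).
Proof.
move=> t0 A3; rewrite [LHS]mxE; apply: eq_Rintegral => s _.
by rewrite (rodrigues _ t0 A3) /quad scale1r !mxE.
Qed.

Lemma continuous_phi_integrand (R : realType) (k : nat) (a b c t : R) :
  continuous (fun s : R => s ^+ k / k`!%:R * (a + sin ((1 - s) * t) / t * b +
    (1 - cos ((1 - s) * t)) / t ^+ 2 * c)).
Proof.
move=> s.
have cs : {for s, continuous (fun r : R => (1 - r) * t)}.
  by apply: cvgMr_tmp; apply: cvgB; [exact: cvg_cst|exact: cvg_id].
apply: cvgM; first by apply: cvgMr_tmp; exact: exprn_continuous.
apply: cvgD; [apply: cvgD; first exact: cvg_cst|]; do 2 apply: cvgMr_tmp.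
- exact: (cvg_comp _ _ cs (@continuous_sin R _)).
- apply: cvgB; first exact: cvg_cst.
  exact: (cvg_comp _ _ cs (@continuous_cos R _)).
Qed.

Lemma phi1E (R : realType) (n : nat) (A : 'M[R]_n.+1) (t : R) :
  t != 0 -> A ^+ 3 = - t ^+ 2 *: A ->
  phi 1 A = quad A 1 ((1 - cos t) / t ^+ 2) ((1 - sin t / t) / t ^+ 2).
Proof.
move=> t0 A3; apply/matrixP => i j; rewrite (phi_entry _ _ _ t0 A3).
apply: etrans.
  apply: (@Rintegral_FTC _ _ (fun s => (1 : 'M[R]_n.+1) i j * s +
    A i j / t ^+ 2 * cos ((1 - s) * t) +
    (A ^+ 2) i j / t ^+ 2 * (s + t^-1 * sin ((1 - s) * t)))).
- exact: continuous_phi_integrand.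
- move=> s.
  have dc := is_derive_comp_rev t (@is_derive_cos R) s.
  have ds := is_derive_comp_rev t (@is_derive_sin R) s.
  by apply: is_derive_eq; rewrite -![_ *: _]/(_ * _) expr0 fact0; field.
- by rewrite /= subr0 subrr mul0r cos0 sin0 !mul1r /quad !mxE; field; exact: t0.
Qed.

(** With the weight s, the antiderivatives come from integration by parts of
    s sin ((1 - s) t) and s cos ((1 - s) t). *)
Lemma phi2E (R : realType) (n : nat) (A : 'M[R]_n.+1) (t : R) :
  t != 0 -> A ^+ 3 = - t ^+ 2 *: A ->
  phi 2 A = quad A 2^-1 ((1 - sin t / t) / t ^+ 2)
    ((2^-1 - (1 - cos t) / t ^+ 2) / t ^+ 2).
Proof.
move=> t0 A3; apply/matrixP => i j; rewrite (phi_entry _ _ _ t0 A3).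
apply: etrans.
  apply: (@Rintegral_FTC _ _ (fun s =>
    (1 : 'M[R]_n.+1) i j * (2^-1 * (s * s)) +
    A i j / t ^+ 2 * (s * cos ((1 - s) * t) + t^-1 * sin ((1 - s) * t)) +
    (A ^+ 2) i j / t ^+ 2 * (2^-1 * (s * s) + t^-1 * (s * sin ((1 - s) * t))
      - (t ^+ 2)^-1 * cos ((1 - s) * t)))).
- exact: continuous_phi_integrand.
- move=> s.
  have dc := is_derive_comp_rev t (@is_derive_cos R) s.
  have ds := is_derive_comp_rev t (@is_derive_sin R) s.
  apply: is_derive_eq; rewrite -![_ *: _]/(_ * _) expr1 (_ : 1`! = 1)%N //.
  by field.
- by rewrite /= subr0 subrr mul0r cos0 sin0 !mul1r /quad !mxE; field; exact: t0.
Qed.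

(** * Identities between the propagators of a skew matrix *)

Section SkewPropagators.
Variables (R : realType) (n : nat) (A : 'M[R]_n.+1) (t : R).
Hypotheses (t0 : t != 0) (A3 : A ^+ 3 = - t ^+ 2 *: A) (AT : A^T = - A).

Let S := sin t / t.
Let C := (1 - cos t) / t ^+ 2.

(** This is sin^2 + cos^2 = 1, and the only relation between S and C that the
    three identities below use. *)
Let SC_circle : S ^+ 2 = 2 * C - t ^+ 2 * C ^+ 2.
Proof. by rewrite /S /C exprMn sin2cos2; field. Qed.

Let expmxE : expmx A = quad A 1 S C.
Proof. by have := rodrigues 1 t0 A3; rewrite scale1r mul1r. Qed.

(** e^(-z) e^z = 1 *)
Lemma expmx_orthogonal : (expmx A)^T * expmx A = 1.
Proof.
rewrite expmxE quad_tr // (quad_mul _ _ _ _ _ _ A3).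
rewrite (_ : 1 = quad A 1 0 0); last by rewrite /quad scale1r !scale0r !addr0.
by congr quad; [ring|ring|ring: SC_circle].
Qed.

(** e^(-z) phi_1(z) = phi_1(-z) *)
Lemma trmx_expmx_phi1 : (expmx A)^T * phi 1 A = (phi 1 A)^T.
Proof.
rewrite expmxE (phi1E t0 A3) -/S -/C !quad_tr // (quad_mul _ _ _ _ _ _ A3).
by congr quad; [ring|field: SC_circle|field].
Qed.

(** phi_1(-z) phi_1(z) = phi_2(z) + phi_2(-z) *)
Lemma trmx_phi1_phi1 : (phi 1 A)^T * phi 1 A = phi 2 A + (phi 2 A)^T.
Proof.
rewrite (phi1E t0 A3) (phi2E t0 A3) -/S -/C !quad_tr //.
rewrite (quad_mul _ _ _ _ _ _ A3) quad_add.
by congr quad; [field|field|field: SC_circle].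
Qed.

End SkewPropagators.

(** Cayley-Hamilton for the cross product: v x B rotates the plane orthogonal
    to B by a right angle and scales it by |B|, and kills B, so applying it two
    further times multiplies by - |B|^2. *)
Lemma tilde_cubed (R : realType) (B : 'cV[R]_3) :
  tilde B ^+ 3 = - enorm B ^+ 2 *: tilde B.
Proof.
rewrite /enorm sqr_sqrtr; last by apply: sumr_ge0 => i _; exact: sqr_ge0.
have [e1 e2] : lift ord0 ord0 = 1 :> 'I_3 /\
    lift ord0 (lift ord0 ord0) = 2 :> 'I_3 by split; apply/val_inj.
rewrite !exprS expr0 mulr1.
apply/matrixP => -[[|[|[|//]]] ?] [[|[|[|//]]] ?];
  rewrite !mxE !big_ord_recl !big_ord0 !mxE;
  by rewrite !big_ord_recl !big_ord0 !mxE /= e1 e2; ring.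
Qed.

(** Producing some t != 0, not the angle c |B| itself, keeps the division by t
    in the closed forms meaningful when c = 0. *)
Lemma scaled_tilde_cubed (R : realType) (B : 'cV[R]_3) (c : R) :
  0 < enorm B ->
  exists2 t, t != 0 & (c *: tilde B) ^+ 3 = - t ^+ 2 *: (c *: tilde B).
Proof.
move=> B0; have [->|c0] := eqVneq c 0.
  by exists 1; rewrite ?oner_eq0 // scale0r scaler0 expr0n.
exists (c * enorm B); first by rewrite mulf_neq0 // gt_eqF.
by rewrite exprZn tilde_cubed !scalerA; congr (_ *: _); ring.
Qed.

(** * Work of the averaged force *)

(** The identity is purely algebraic: E, P and Q enter only through the three
    relations satisfied by the propagators. *)
Lemma kinetic_gain (R : comNzRingType) (n : nat) (h : R)
    (E P Q : 'M[R]_n) (v g : 'cV[R]_n) :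
  E^T *m E = 1%:M -> E^T *m P = P^T -> P^T *m P = Q + Q^T ->
  let v' := E *m v + h *: (P *m g) in
  let d := h *: (P *m v) + h ^+ 2 *: (Q *m g) in
  (v'^T *m v') 0 0 = (v^T *m v) 0 0 + 2 * (g^T *m d) 0 0.
Proof.
move=> EE EP PP v' d.
have tr11 (M : 'M[R]_1) : M^T 0 0 = M 0 0 by rewrite mxE.
have PE : P^T *m E = P by rewrite -[LHS]trmxK trmx_mul trmxK EP trmxK.
have vPg : (v^T *m P^T *m g) 0 0 = (g^T *m P *m v) 0 0.
  by rewrite -tr11 !trmx_mul !trmxK mulmxA.
have gQg : (g^T *m Q^T *m g) 0 0 = (g^T *m Q *m g) 0 0.
  by rewrite -tr11 !trmx_mul !trmxK mulmxA.
have -> : v'^T *m v' = v^T *m v + h *: (v^T *m P^T *m g) +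
    (h *: (g^T *m P *m v) + h ^+ 2 *: (g^T *m (Q + Q^T) *m g)).
  have -> : v'^T = v^T *m E^T + h *: (g^T *m P^T).
    by rewrite -!trmx_mul -linearZ -linearD.
  rewrite -PP mulmxDl !mulmxDr -!scalemxAl -!scalemxAr scalerA -expr2 !mulmxA.
  rewrite -[v^T *m E^T *m E]mulmxA EE mulmx1 -[v^T *m E^T *m P]mulmxA EP.
  by rewrite -[g^T *m P^T *m E]mulmxA PE.
rewrite mulmxDr mulmxDl /d mulmxDr -!scalemxAr !mulmxA.
have e M N : (M + N : 'M[R]_1) 0 0 = M 0 0 + N 0 0 by rewrite mxE.
have z a M : (a *: M : 'M[R]_1) 0 0 = a * M 0 0 by rewrite mxE.
by rewrite !(e, z) vPg gQg; ring.
Qed.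

Lemma is_derive_line (R : realType) (V : normedModType R) (U : V -> R)
    (x w : V) (s : R) :
  derivable U (x + s *: w) w ->
  is_derive s (1 : R) (fun s => U (x + s *: w)) ('D_w U (x + s *: w)).
Proof.
(* The two derivatives are limits of the same difference quotient. *)
have E :
    (fun r : R =>
       r^-1 *: (U (x + (r *: (1 : R) + s) *: w) - U (x + s *: w))) =
    (fun r : R => r^-1 *: (U (r *: w + (x + s *: w)) - U (x + s *: w))).
  by apply/funext => r; rewrite scalerDl addrCA /GRing.scale /= mulr1.
by move=> dU; split; rewrite ?/derivable ?/derive /= E.
Qed.

Lemma derive_gradient (R : realType) (U : 'cV[R]_3 -> R) (y w : 'cV[R]_3) :
  differentiable U y -> 'D_w U y = \sum_(i < 3) gradient U y i 0 * w i 0.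
Proof.
move=> dU; rewrite deriveE //.
have wE : w = \sum_(i < 3) w i 0 *: delta_mx i 0.
  by rewrite {1}[w]matrix_sum_delta; apply: eq_bigr => i _; rewrite big_ord1.
rewrite {1}wE linear_sum; apply: eq_bigr => i _.
by rewrite linearZ mxE deriveE // mulrC.
Qed.

(** Along the segment, - U has derivative the scalar product of F with y - x;
    as y - x does not depend on s, only F gets averaged. *)
Lemma potential_drop (R : realType) (U : 'cV[R]_3 -> R)
    (F : 'cV[R]_3 -> 'cV[R]_3) (x y : 'cV[R]_3) :
  (forall z, differentiable U z) -> continuous F ->
  (forall z, F z = - gradient U z) ->
  U x - U y =
    \sum_(i < 3) intmx (fun s => F (x + s *: (y - x))) i 0 * (y - x) i 0.
Proof.
move=> dU cF FU; set w := y - x.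
have cFi i : continuous (fun s : R => F (x + s *: w) i 0).
  move=> s; apply: (@continuous_comp _ _ _ (fun s : R => F (x + s *: w))
    (fun M : 'cV[R]_3 => M i 0)); last exact: coord_continuous.
  apply: continuous_comp; last exact: cF.
  by apply: cvgD; [exact: cvg_cst|apply: cvgZr_tmp; exact: cvg_id].
have cFw i : continuous (fun s : R => F (x + s *: w) i 0 * w i 0).
  by move=> s; apply: cvgMr_tmp; exact: cFi.
have integrable_cont (f : R -> R) : continuous f ->
    (@lebesgue_measure R).-integrable `[0, 1] (EFin \o f).
  move=> cf; apply: continuous_compact_integrable; first exact: segment_compact.
  exact: continuous_subspaceT.
transitivity (\int[lebesgue_measure]_(s in `[0, 1])
    \sum_(i < 3) (F (x + s *: w) i 0 * w i 0)).
  apply/esym; apply: etrans.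
    apply: (@Rintegral_FTC _ _ (fun s => - U (x + s *: w))).
  - move=> s; under eq_fun do rewrite !big_ord_recl big_ord0.
    by do 3 (apply: cvgD; first exact: cFw); exact: cvg_cst.
  - move=> s.
    have dUs := @is_derive_line _ _ U x w s (diff_derivable (dU _)).
    apply: is_derive_eq; rewrite derive_gradient // -sumrN.
    by apply: eq_bigr => i _; rewrite FU [in RHS]mxE mulNr.
  - by rewrite /= scale1r scale0r addr0 /w [x + _]addrC subrK opprK addrC.
have iFw i := integrable_cont _ (cFw i).
under eq_Rintegral do rewrite !big_ord_recl big_ord0 addr0.
rewrite RintegralD //; last first.
  by apply: integrable_cont => s; apply: cvgD; exact: cFw.
rewrite RintegralD // !big_ord_recl big_ord0 addr0 ![intmx _ _ _]mxE.
by rewrite !RintegralZr //; exact: integrable_cont.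
Qed.

Lemma enorm_sqr (R : realType) (v : 'cV[R]_3) :
  enorm v ^+ 2 = (v^T *m v) 0 0.
Proof.
rewrite sqr_sqrtr; last by apply: sumr_ge0 => i _; exact: sqr_ge0.
by rewrite mxE; apply: eq_bigr => i _; rewrite mxE.
Qed.

Theorem theorem3p2 (R : realType) (eps h : R) (B : 'cV[R]_3)
    (U : 'cV[R]_3 -> R) (F : 'cV[R]_3 -> 'cV[R]_3) (x v : nat -> 'cV[R]_3)
    (eps_gt0 : 0 < eps) (eps_lt1 : eps < 1)
    (B_ge1 : 1 <= enorm B)
    (U_diff : forall y, differentiable U y)
    (U_C1 : continuous (gradient U))
    (F_pot : forall y, F y = - gradient U y)
    (xv_EEP : forall n, EEP_step eps h B F (x n) (v n) (x n.+1) (v n.+1)) :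
  forall n, energy U (x n.+1) (v n.+1) = energy U (x n) (v n).
Proof.
move=> n; have [xE vE] := xv_EEP n.
set K := (h / eps) *: tilde B in xE vE.
set g := intmx _ in xE vE.
have [t t0 K3] := scaled_tilde_cubed (h / eps) (lt_le_trans ltr01 B_ge1).
rewrite -/K in K3.
have KT : K^T = - K by rewrite linearZ /= tilde_skew scalerN.
have cF : continuous F.
  by rewrite (funext F_pot : F = _) => y; apply: continuousN; exact: U_C1.
have dU : U (x n) - U (x n.+1) = (g^T *m (x n.+1 - x n)) 0 0.
  rewrite (potential_drop (x n) (x n.+1) U_diff cF F_pot) -/g [RHS]mxE.
  by apply: eq_bigr => i _; rewrite [in RHS]mxE.
have xd : x n.+1 - x n = h *: (phi 1 K *m v n) + h ^+ 2 *: (phi 2 K *m g).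
  by apply/eqP; rewrite subr_eq addrC addrA; apply/eqP.
have dT := kinetic_gain h (v n) g (expmx_orthogonal t0 K3 KT)
  (trmx_expmx_phi1 t0 K3 KT) (trmx_phi1_phi1 t0 K3 KT).
rewrite /= -vE -xd -dU in dT.
by rewrite /energy !enorm_sqr dT; field.
Qed.
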